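(* For any integer $N>1$, there are at most $2(N-1)$ integer triples $(a,b,c)$ with $0<a+1<b<c$, $c-a=N$ and $P_a+P_c=2P_b$.
   Context: For an integer $n$, $P_n=\frac{n(n+1)(2n+1)}{6}$ (for $n\ge 1$ this is $\sum_{k=1}^n k^2$, the $n$th square pyramidal number). For $0<a+1<b<c$ the equation $P_a+P_c=2P_b$ is equivalent to $(a+1)^2+\cdots+b^2=(b+1)^2+\cdots+c^2$. *)

(* Defs.v *)
From mathcomp Require Import all_boot all_order all_algebra.
From mathcomp Require Import finmap.
From mathcomp Require Import boolp classical_sets functions cardinality.

Set Implicit Arguments.
Unset Strict Implicit.
Unset Printing Implicit Defensive.

Import Order.TTheory GRing.Theory Num.Theory.
Local Open Scope ring_scope.

(* Valued in [rat] so that the division by 6 is the exact one (the value is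
   always an integer). *)
Definition pyramidal (n : int) : rat :=
  (n * (n + 1) * (2 * n + 1))%:~R / 6.

Definition pyramidal_triples (N : int) : set (int * int * int) :=
  [set t | let: (a, b, c) := t in
     [/\ 0 < a + 1, a + 1 < b, b < c, c - a = N
       & pyramidal a + pyramidal c = 2 * pyramidal b]].

(* Main.v *)
(* Put [M := a + c + 1] and [D := 2 b + 1 - M]. Since [24 P_n = x^3 - x] with
   [x = 2 n + 1], and since [2 a + 1] and [2 c + 1] are [M - N] and [M + N], the
   equation becomes [3 M (N^2 - D M - D^2) = D^3 - D]. The inequalities on
   [(a, b, c)] force [0 < D < N], and for each such [D] the equation is
   quadratic in [M] with sum of roots [(N^2 - D^2) / D]. So the triple is
   determined by [D] and by whether [M] exceeds half that sum. *)
Require Import Defs.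
From mathcomp Require Import all_boot all_order all_algebra.
From mathcomp Require Import finmap.
From mathcomp Require Import boolp classical_sets functions cardinality.
From mathcomp Require Import zify lra.

Set Implicit Arguments.
Unset Strict Implicit.
Unset Printing Implicit Defensive.

Import Order.TTheory GRing.Theory Num.Theory.
Local Open Scope fset_scope.
Local Open Scope ring_scope.

Lemma finite_card_inj_lt (T : choiceType) (A : set T) (n : nat) (f : T -> nat) :
  {in A &, injective f} -> (forall x, A x -> (f x < n)%N) ->
  finite_set A /\ (#|` fset_set A| <= n)%N.
Proof.
move=> f_inj f_lt.
have leAn : (A #<= `I_n)%card.
  rewrite -(card_le_eql (inj_card_eq f_inj)).
  by apply: subset_card_le => _ [x Ax <-]; exact: f_lt.
by split; [apply/finite_set_leP; exists n | exact: geq_card_fset_set].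
Qed.

Definition center (t : int * int * int) : int := t.1.1 + t.2 + 1.

Definition defect (t : int * int * int) : int := 2 * t.1.2 + 1 - center t.

Lemma pyramidal_eqE (a b c : int) :
  pyramidal a + pyramidal c = 2 * pyramidal b ->
  a * (a + 1) * (2 * a + 1) + c * (c + 1) * (2 * c + 1) =
  2 * (b * (b + 1) * (2 * b + 1)).
Proof.
rewrite /pyramidal => eq_abc; apply: (@intr_inj rat).
rewrite rmorphD [RHS]rmorphM /=; lra.
Qed.

Lemma center_defect_eq (N : int) (t : int * int * int) :
  pyramidal_triples N t ->
  3 * center t * (N ^+ 2 - defect t * center t - defect t ^+ 2) =
  defect t ^+ 3 - defect t.
Proof.
case: t => [[a b] c] [_ _ _ defN /pyramidal_eqE eq_abc].
rewrite -defN /defect /center /=; lia.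
Qed.

Lemma center_gt0 (N : int) (t : int * int * int) :
  pyramidal_triples N t -> 0 < center t.
Proof. by case: t => [[a b] c] [????]; rewrite /center /=; lia. Qed.

(** The defect is (b - a) - (c - b), a difference of positive integers with sum [N]. If D <= 0, the
    left side of [center_defect_eq] is positive, whereas D^3 - D <= 0 for every integer D <= 0. *)
Lemma defect_bounds (N : int) (t : int * int * int) :
  pyramidal_triples N t -> 0 < defect t < N.
Proof.
move=> tN; have := center_defect_eq tN; have := center_gt0 tN.
have : - N < defect t < N.
  by case: t tN => [[a b] c] []; rewrite /defect /center /=; lia.
move: (center t) (defect t) => M D /andP[D_gtN D_ltN] M_gt0 eqMD.
rewrite D_ltN andbT ltNge; apply/negP => D_le0.
have DM_le0 : D * M <= 0 by nia.
have D2_lt : D ^+ 2 < N ^+ 2 by nia.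
have lhs_gt0 : 0 < 3 * M * (N ^+ 2 - D * M - D ^+ 2).
  by rewrite !mulr_gt0//; lia.
have : D ^+ 3 - D <= 0 by nia.
by rewrite -eqMD leNgt lhs_gt0.
Qed.

Definition larger_root (N : int) (t : int * int * int) : bool :=
  N ^+ 2 - defect t ^+ 2 < 2 * defect t * center t.

Lemma triple_inj (N : int) (t u : int * int * int) :
  pyramidal_triples N t -> pyramidal_triples N u ->
  defect t = defect u -> larger_root N t = larger_root N u -> t = u.
Proof.
move=> tN uN eqD; rewrite /larger_root -eqD => eq_root.
have eqM : center t = center u.
  have := center_defect_eq tN; have := center_defect_eq uN.
  rewrite -eqD => eq_u eq_t; apply/eqP; rewrite -subr_eq0; apply/negPn/negP.
  move=> neqM; have /andP[D_gt0 _] := defect_bounds tN.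
  (* Subtract the two cubic relations and cancel the nonzero difference of the centers. *)
  have vieta : defect t * (center t + center u) = N ^+ 2 - defect t ^+ 2.
    by apply: (mulfI neqM); lia.
  have neqDM : defect t * (center t - center u) != 0.
    by rewrite mulf_neq0// gt_eqF.
  (* By [vieta], the two values of 2 D M are distinct with mean N^2 - D^2, so exactly one exceeds
     it, against [eq_root]. *)
  lia.
move: eqM eqD; case: t tN {eq_root} => [[a b] c] [_ _ _ defN _].
case: u uN => [[a' b'] c'] [_ _ _ defN' _]; rewrite /defect /center /=.
by move=> eqM eqD; congr (_, _, _); lia.
Qed.

Theorem theorem2p1 (N : int) (hN : 1 < N) :
  finite_set (pyramidal_triples N) /\
  (#|` fset_set (pyramidal_triples N)|)%:Z <= 2 * (N - 1).
Proof.
(* The flag is the low bit; the shift by 1 sends defects 1, ..., N - 1 to 0, ..., N - 2, so [f]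
   stays below 2 (N - 1). *)
pose f t : nat := (larger_root N t + `|defect t - 1|.*2)%N.
have [||fin le_card] := @finite_card_inj_lt _ (pyramidal_triples N) (`|N - 1|.*2) f.
- move=> t u /set_mem tN /set_mem uN eq_f.
  have /andP[Dt_gt0 _] := defect_bounds tN.
  have /andP[Du_gt0 _] := defect_bounds uN.
  by apply: (triple_inj tN uN); move: eq_f; rewrite /f;
    case: (larger_root N t); case: (larger_root N u) => //; lia.
- by move=> t /defect_bounds; rewrite /f; case: (larger_root N t); lia.
by split=> //; lia.
Qed.
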